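(* Consider the matrices produced by the truncated doubling construction described in the context. Let $K_1^G:=(\Phi_{1,1}^G)^{\sf T}\Sigma_1^Y\Phi_{1,1}^H$ and, for $j\ge2$, define recursively $$K_j^G:=(\Phi_{1,j}^G)^{\sf T}\begin{bmatrix}2\gamma K_{j-1}^G\Sigma_{1,j-1}^H\Omega_{j-1}^{\sf T}\Sigma_{1,j-1}^GK_{j-1}^G & K_{j-1}^GV_j^Y(\Upsilon_j^H)^{1/2}\\ (\Upsilon_j^G)^{1/2}(U_j^Y)^{\sf T}K_{j-1}^G & 2\gamma\Sigma_j^Y\end{bmatrix}\Phi_{1,j}^H,\qquad K_j^H:=(K_j^G)^{\sf T},$$ where $\Upsilon_j^G=I_{r_{j-1}^G}+4\gamma^2\Sigma_j^Y(\Sigma_j^Y)^{\sf T}$ and $\Upsilon_j^H=I_{r_{j-1}^H}+4\gamma^2(\Sigma_j^Y)^{\sf T}\Sigma_j^Y$. Then for every $j\ge2$ $$L_j^G=2\gamma\,\Sigma_{1,j}^G\,K_j^G\,\Sigma_{1,j}^H\,\Omega_j^{\sf T},\qquad L_j^H=2\gamma\,\Sigma_{1,j}^H\,K_j^H\,\Sigma_{1,j}^G\,\Omega_j,$$ and moreover $$K_j^G=(\Phi_{1,j}^G)^{\sf T}\,(K_{j-1}^G\oplus I_{r_{j-1}^G})\begin{bmatrix}2\gamma V_j^Y(\Sigma_j^Y)^{\sf T}(U_j^Y)^{\sf T} & V_j^Y(\Upsilon_j^H)^{1/2}\\ (\Upsilon_j^G)^{1/2}(U_j^Y)^{\sf T}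 & 2\gamma\Sigma_j^Y\end{bmatrix}(K_{j-1}^G\oplus I_{r_{j-1}^H})\,\Phi_{1,j}^H .$$
   Context: Setting. $A\in\mathbb{R}^{n\times n}$, $B\in\mathbb{R}^{n\times m}$, $C\in\mathbb{R}^{l\times n}$, with $B$ and $C^{\sf T}$ of full column rank, $G=BB^{\sf T}$, $H=C^{\sf T}C$, $(A,B)$ stabilizable and $(A,C)$ detectable. $\gamma>0$ is such that $A_\gamma:=A-\gamma I$ and $K_\gamma:=A_\gamma^{\sf T}+HA_\gamma^{-1}G$ are nonsingular. Put $\widetilde A_\gamma:=A_\gamma^{-1}(A+\gamma I)=I+2\gamma A_\gamma^{-1}$, $U_0=A_\gamma^{-1}B$, $V_0=A_\gamma^{-\sf T}C^{\sf T}$, $U_1=\widetilde A_\gamma U_0$, $V_1=\widetilde A_\gamma^{\sf T}V_0$, $Y_0=B^{\sf T}A_\gamma^{-\sf T}C^{\sf T}$, $T_0=U_0^{\sf T}V_0$ and $Y_1=\begin{bmatrix}0&Y_0\\ Y_0&2\gamma T_0\end{bmatrix}\in\mathbb{R}^{2m\times 2l}$. $M\oplus N$ denotes the block-diagonal matrix with blocks $M,N$; $\otimes$ is the Kronecker product; $\|\cdot\|$ is the spectral norm. In all SVDs below, diagonal factors $\Sigma$ carry the singular values in nonincreasing order; $\varepsilon_1,\varepsilon_2,\dots$ are small tolerances. Step 1. QR factorizations with column pivoting: $[U_0,U_1](P_1^U)^{\sf T}=Q_1^UR_1^U$, $[V_0,V_1](P_1^V)^{\sf T}=Q_1^VR_1^V$,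 with $P_1^U,P_1^V$ permutation matrices, $Q_1^U\in\mathbb{R}^{n\times p_1}$, $Q_1^V\in\mathbb{R}^{n\times q_1}$ with orthonormal columns, $R_1^U\in\mathbb{R}^{p_1\times 2m}$, $R_1^V\in\mathbb{R}^{q_1\times2l}$, $p_1\le2m$, $q_1\le2l$. Full SVD $Y_1=U_1^Y\Sigma_1^Y(V_1^Y)^{\sf T}$ ($\Sigma_1^Y\in\mathbb{R}^{2m\times2l}$); $\Upsilon_1^G=I_{2m}+\Sigma_1^Y(\Sigma_1^Y)^{\sf T}$, $\Upsilon_1^H=I_{2l}+(\Sigma_1^Y)^{\sf T}\Sigma_1^Y$. Thin SVDs $R_1^UP_1^UU_1^Y(\Upsilon_1^G)^{-1/2}=\Theta_1^G\Sigma_1^G(\Phi_1^G)^{\sf T}$, $R_1^VP_1^VV_1^Y(\Upsilon_1^H)^{-1/2}=\Theta_1^H\Sigma_1^H(\Phi_1^H)^{\sf T}$ with $\Theta_1^G,\Sigma_1^G\in\mathbb{R}^{p_1\times p_1}$, $\Theta_1^H,\Sigma_1^H\in\mathbb{R}^{q_1\times q_1}$, $\Theta$'s orthogonal, and $\Phi_1^G\in\mathbb{R}^{2m\times p_1}$, $\Phi_1^H\in\mathbb{R}^{2l\times q_1}$ with orthonormal columns. Partitioning (used for every $j\ge1$). Write $\Sigma_j^G=\Sigma_{1,j}^G\oplus\Sigma_{2,j}^G$, $\Sigma_j^H=\Sigma_{1,j}^H\oplus\Sigma_{2,j}^H$ with $\Sigma_{1,j}^G\in\mathbb{R}^{r_j^G\times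 r_j^G}$, $\Sigma_{1,j}^H\in\mathbb{R}^{r_j^H\times r_j^H}$, $\|\Sigma_{2,j}^G\|\le\varepsilon_j\|\Sigma_{1,j}^G\|$, $\|\Sigma_{2,j}^H\|\le\varepsilon_j\|\Sigma_{1,j}^H\|$, and conformally by columns $\Theta_j^G=[\Theta_{1,j}^G,\Theta_{2,j}^G]$, $\Theta_j^H=[\Theta_{1,j}^H,\Theta_{2,j}^H]$, $\Phi_j^G=[\Phi_{1,j}^G,\Phi_{2,j}^G]$, $\Phi_j^H=[\Phi_{1,j}^H,\Phi_{2,j}^H]$. Put $\mathcal{Q}_1^U:=Q_1^U\Theta_{1,1}^G$, $\mathcal{Q}_1^V:=Q_1^V\Theta_{1,1}^H$, $N_1^G:=(\Theta_{1,1}^G)^{\sf T}R_1^UP_1^U$, $N_1^H:=(\Theta_{1,1}^H)^{\sf T}R_1^VP_1^V$, $Y_1^{(1)}:=Y_1$. Step $j\to j+1$ ($j\ge1$). Let $\Omega_j:=(\mathcal{Q}_j^U)^{\sf T}\mathcal{Q}_j^V$. Compute the QR factorizations $[\mathcal{Q}_j^U,\widetilde A_\gamma^{2^j}\mathcal{Q}_j^U]=[\mathcal{Q}_j^U,Q_{j+1}^U]\begin{bmatrix}I_{r_j^G}&R_{12}^{j,U}\\0&R_2^{j,U}\end{bmatrix}$, $[\mathcal{Q}_j^V,(\widetilde A_\gamma^{\sf T})^{2^j}\mathcal{Q}_j^V]=[\mathcal{Q}_j^V,Q_{j+1}^V]\begin{bmatrix}I_{r_j^H}&R_{12}^{j,V}\\0&R_2^{j,V}\end{bmatrix}$,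 where $[\mathcal{Q}_j^U,Q_{j+1}^U]\in\mathbb{R}^{n\times p_{j+1}}$ and $[\mathcal{Q}_j^V,Q_{j+1}^V]\in\mathbb{R}^{n\times q_{j+1}}$ have orthonormal columns, $p_{j+1}\le 2r_j^G$, $q_{j+1}\le2r_j^H$. Full SVD $\Sigma_{1,j}^G\Omega_j\Sigma_{1,j}^H=U_{j+1}^Y\Sigma_{j+1}^Y(V_{j+1}^Y)^{\sf T}$ with $U_{j+1}^Y\in\mathbb{R}^{r_j^G\times r_j^G}$, $V_{j+1}^Y\in\mathbb{R}^{r_j^H\times r_j^H}$ orthogonal and $\Sigma_{j+1}^Y\in\mathbb{R}^{r_j^G\times r_j^H}$; $\Upsilon_{j+1}^G:=I_{r_j^G}+4\gamma^2\Sigma_{j+1}^Y(\Sigma_{j+1}^Y)^{\sf T}$, $\Upsilon_{j+1}^H:=I_{r_j^H}+4\gamma^2(\Sigma_{j+1}^Y)^{\sf T}\Sigma_{j+1}^Y$. Define $$L_j^G:=2\gamma N_j^G\,[I_{2^jm}+Y_j^{(j)}(Y_j^{(j)})^{\sf T}]^{-1}Y_j^{(j)}(N_j^H)^{\sf T}\Omega_j^{\sf T},\qquad L_j^H:=2\gamma N_j^H\,[I_{2^jl}+(Y_j^{(j)})^{\sf T}Y_j^{(j)}]^{-1}(Y_j^{(j)})^{\sf T}(N_j^G)^{\sf T}\Omega_j .$$ Thin SVDs $$\begin{bmatrix}I&R_{12}^{j,U}\\0&R_2^{j,U}\end{bmatrix}\begin{bmatrix}I&-L_j^G\\0&I\end{bmatrix}\left\{\Sigma_{1,j}^G\oplus[\Sigma_{1,j}^GU_{j+1}^Y(\Upsilon_{j+1}^G)^{-1/2}]\right\}=\Theta_{j+1}^G\Sigma_{j+1}^G(\Phi_{j+1}^G)^{\sf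 T},$$ $$\begin{bmatrix}I&R_{12}^{j,V}\\0&R_2^{j,V}\end{bmatrix}\begin{bmatrix}I&-L_j^H\\0&I\end{bmatrix}\left\{\Sigma_{1,j}^H\oplus[\Sigma_{1,j}^HV_{j+1}^Y(\Upsilon_{j+1}^H)^{-1/2}]\right\}=\Theta_{j+1}^H\Sigma_{j+1}^H(\Phi_{j+1}^H)^{\sf T},$$ with $\Theta_{j+1}^G,\Sigma_{j+1}^G\in\mathbb{R}^{p_{j+1}\times p_{j+1}}$, $\Phi_{j+1}^G\in\mathbb{R}^{2r_j^G\times p_{j+1}}$, $\Theta_{j+1}^H,\Sigma_{j+1}^H\in\mathbb{R}^{q_{j+1}\times q_{j+1}}$, $\Phi_{j+1}^H\in\mathbb{R}^{2r_j^H\times q_{j+1}}$ ($\Theta$'s orthogonal, $\Phi$'s with orthonormal columns), partitioned with tolerance $\varepsilon_{j+1}$ as $\Sigma_{j+1}^G=\Sigma_{1,j+1}^G\oplus\Sigma_{2,j+1}^G$, $\Sigma_{j+1}^H=\Sigma_{1,j+1}^H\oplus\Sigma_{2,j+1}^H$ with $\Sigma_{1,j+1}^G\in\mathbb{R}^{r_{j+1}^G\times r_{j+1}^G}$, $\Sigma_{1,j+1}^H\in\mathbb{R}^{r_{j+1}^H\times r_{j+1}^H}$, $\|\Sigma_{2,j+1}^G\|\le\varepsilon_{j+1}\|\Sigma_{1,j+1}^G\|$, $\|\Sigma_{2,j+1}^H\|\le\varepsilon_{j+1}\|\Sigma_{1,j+1}^H\|$, and conformally by columns $\Theta_{j+1}^G=[\Theta_{1,j+1}^G,\Theta_{2,j+1}^G]$,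 $\Theta_{j+1}^H=[\Theta_{1,j+1}^H,\Theta_{2,j+1}^H]$, $\Phi_{j+1}^G=[\Phi_{1,j+1}^G,\Phi_{2,j+1}^G]$, $\Phi_{j+1}^H=[\Phi_{1,j+1}^H,\Phi_{2,j+1}^H]$. Finally $\mathcal{Q}_{j+1}^U:=[\mathcal{Q}_j^U,Q_{j+1}^U]\Theta_{1,j+1}^G$, $\mathcal{Q}_{j+1}^V:=[\mathcal{Q}_j^V,Q_{j+1}^V]\Theta_{1,j+1}^H$, $M_j^G:=\begin{bmatrix}I&R_{12}^{j,U}\\0&R_2^{j,U}\end{bmatrix}(I_2\otimes N_j^G)$, $M_j^H:=\begin{bmatrix}I&R_{12}^{j,V}\\0&R_2^{j,V}\end{bmatrix}(I_2\otimes N_j^H)$, $N_{j+1}^G:=(\Theta_{1,j+1}^G)^{\sf T}M_j^G$, $N_{j+1}^H:=(\Theta_{1,j+1}^H)^{\sf T}M_j^H$, and $Y_{j+1}^{(j+1)}:=Y_{j+1}^{(j)}:=\begin{bmatrix}0&Y_j^{(j)}\\ Y_j^{(j)}&2\gamma(N_j^G)^{\sf T}\Omega_jN_j^H\end{bmatrix}\in\mathbb{R}^{2^{j+1}m\times2^{j+1}l}$. *)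

(* Defs.v *)
From HB Require Import structures.
From mathcomp Require Import all_boot all_order all_algebra.
From mathcomp Require Import classical_sets reals.
From mathcomp.real_closed Require Import complex mxtens.

Set Implicit Arguments.
Unset Strict Implicit.
Unset Printing Implicit Defensive.
Import Order.TTheory GRing.Theory Num.Theory.
Local Open Scope ring_scope.

(* Continuous-time stability: the spectrum lies in the open left half-plane. *)
Definition hurwitz (R : realType) (n : nat) (M : 'M[R]_n) : Prop :=
  forall z : R[i], eigenvalue (map_mx (real_complex R) M) z -> complex.Re z < 0.

Definition stabilizable (R : realType) (n m : nat)
    (A : 'M[R]_n) (B : 'M[R]_(n, m)) : Prop :=
  exists F : 'M[R]_(m, n), hurwitz (A - B *m F).

Definition detectable (R : realType) (n l : nat)
    (A : 'M[R]_n) (C : 'M[R]_(l, n)) : Prop :=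
  exists F : 'M[R]_(n, l), hurwitz (A - F *m C).

Definition enorm (R : realType) (n : nat) (v : 'cV[R]_n) : R :=
  Num.sqrt (\sum_i v i 0 ^+ 2).

Definition spectral_norm (R : realType) (m n : nat) (M : 'M[R]_(m, n)) : R :=
  sup [set x : R | exists2 v : 'cV[R]_n, enorm v <= 1 & x = enorm (M *m v)]%classic.

Definition orthonormal_cols (R : realType) (m n : nat) (Q : 'M[R]_(m, n)) : Prop :=
  Q^T *m Q = 1%:M.

(* [is_trig_mx] means lower triangular. *)
Definition upper_trapezoidal (R : realType) (m n : nat) (M : 'M[R]_(m, n)) : Prop :=
  is_trig_mx M^T.

Definition singular_value_mx (R : realType) (a b : nat) (S : 'M[R]_(a, b)) : Prop :=
  [/\ is_diag_mx S,
      (forall (i : 'I_a) (j : 'I_b), i = j :> nat -> 0 <= S i j)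
    & (forall (i i' : 'I_a) (j j' : 'I_b), i = j :> nat -> i' = j' :> nat ->
         (i <= i')%N -> S i' j' <= S i j)].

(* Full SVD when [a = m] and [b = n] (square factors with orthonormal columns
   are orthogonal); thin SVD when only one of the outer factors is square. *)
Definition is_svd (R : realType) (m n a b : nat) (M : 'M[R]_(m, n))
    (U : 'M[R]_(m, a)) (S : 'M[R]_(a, b)) (V : 'M[R]_(n, b)) : Prop :=
  [/\ orthonormal_cols U, singular_value_mx S, orthonormal_cols V
    & M = U *m S *m V^T].

Definition dsum (R : realType) (a b c d : nat)
    (M : 'M[R]_(a, b)) (N : 'M[R]_(c, d)) : 'M[R]_(a + c, b + d) :=
  block_mx M 0 0 N.

(* The Kronecker product of the 2 x 2 identity and [M]; see [I2_kronE]. *)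
Definition I2_kron (R : realType) (a b : nat) (M : 'M[R]_(a, b)) :
  'M[R]_(a + a, b + b) := dsum M M.

Lemma two_mul (a : nat) : (2 * a = a + a)%N.
Proof. by rewrite mul2n -addnn. Qed.

Lemma I2_kronE (R : realType) (a b : nat) (M : 'M[R]_(a, b)) :
  I2_kron M = castmx (two_mul a, two_mul b) ((1%:M : 'M[R]_2) *t M).
Proof.
have val0 c (i : 'I_c) : cast_ord (esym (two_mul c)) (lshift c i)
    = mxtens_index (0 : 'I_2, i) by apply: val_inj; rewrite /= mul0n.
have val1 c (i : 'I_c) : cast_ord (esym (two_mul c)) (rshift c i)
    = mxtens_index (1 : 'I_2, i) by apply: val_inj; rewrite /= mul1n.
apply/matrixP => i j; rewrite castmxE /I2_kron /dsum.
case: (split_ordP i) => i' ->; case: (split_ordP j) => j' ->;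
  rewrite ?val0 ?val1 tensmxE.
- by rewrite block_mxEul [1%:M _ _]mxE mul1r.
- by rewrite block_mxEur [1%:M _ _]mxE mul0r mxE.
- by rewrite block_mxEdl [1%:M _ _]mxE mul0r mxE.
- by rewrite block_mxEdr [1%:M _ _]mxE mul1r.
Qed.

(* The power 1/2 of a diagonal matrix with nonnegative diagonal. *)
Definition diag_sqrt (R : realType) (a : nat) (D : 'M[R]_a) : 'M[R]_a :=
  diag_mx (\row_i Num.sqrt (D i i)).

Lemma diag_sqrtK (R : realType) (a : nat) (D : 'M[R]_a) :
  is_diag_mx D -> (forall i, 0 <= D i i) -> diag_sqrt D *m diag_sqrt D = D.
Proof.
move=> /is_diag_mxP diagD D_ge0; rewrite /diag_sqrt mulmx_diag.
apply/matrixP => i j; rewrite !mxE.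
case: (eqVneq i j) => [<-|neq_ij]; last by rewrite mulrb diagD.
by rewrite mulrb -expr2 sqr_sqrtr.
Qed.

Definition Ashift (R : realType) (n : nat) (A : 'M[R]_n) (g : R) : 'M[R]_n :=
  A - g%:M.

Definition Kshift (R : realType) (n m l : nat) (A : 'M[R]_n)
    (B : 'M[R]_(n, m)) (C : 'M[R]_(l, n)) (g : R) : 'M[R]_n :=
  (Ashift A g)^T + (C^T *m C) *m invmx (Ashift A g) *m (B *m B^T).

Definition Atilde (R : realType) (n : nat) (A : 'M[R]_n) (g : R) : 'M[R]_n :=
  invmx (Ashift A g) *m (A + g%:M).

Definition U0 (R : realType) (n m : nat) (A : 'M[R]_n) (B : 'M[R]_(n, m)) (g : R) :
  'M[R]_(n, m) := invmx (Ashift A g) *m B.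

Definition V0 (R : realType) (n l : nat) (A : 'M[R]_n) (C : 'M[R]_(l, n)) (g : R) :
  'M[R]_(n, l) := (invmx (Ashift A g))^T *m C^T.

Definition Y0 (R : realType) (n m l : nat) (A : 'M[R]_n)
    (B : 'M[R]_(n, m)) (C : 'M[R]_(l, n)) (g : R) : 'M[R]_(m, l) :=
  B^T *m (invmx (Ashift A g))^T *m C^T.

Definition T0 (R : realType) (n m l : nat) (A : 'M[R]_n)
    (B : 'M[R]_(n, m)) (C : 'M[R]_(l, n)) (g : R) : 'M[R]_(m, l) :=
  (U0 A B g)^T *m V0 A C g.

(* [dbl k j] is [2 ^ j * k], in a form to which [block_mx] applies. *)
Fixpoint dbl (k j : nat) : nat :=
  if j is i.+1 then (dbl k i + dbl k i)%N else k.

Lemma dblE (k j : nat) : dbl k j = (2 ^ j * k)%N.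
Proof. by elim: j => [|j IHj] /=; rewrite ?mul1n// IHj -two_mul mulnA -expnS. Qed.

(* For [j >= 2], [U_j^Y] has order [r_{j-1}] and [Phi_j] has [2 r_{j-1}] rows;
   for [j = 1] both numbers are [2 k], where [k] is the number of inputs
   (or outputs). *)
Definition svd_dim (k : nat) (r : nat -> nat) (j : nat) : nat :=
  if j is i.+2 then r i.+1 else (k + k)%N.

Definition phi_dim (k : nat) (r : nat -> nat) (j : nat) : nat :=
  if j is i.+2 then (r i.+1 + r i.+1)%N else (k + k)%N.

(* The quantities attached to one of the two sides of the construction: the
   side of G and U ([k = m]) or the side of H and V ([k = l]).  Indices start
   at 1; the members of index 0 (and [cnew], [Qnew] of index 1) exist only
   because the families are total, and nothing is assumed about them.  The order [p_j] (resp. [q_j]) is [rk j +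
   trunc j], where [trunc j] counts the discarded singular values; it is also
   [rk j.-1 + cnew j] when [j >= 2], where [cnew j] counts the new columns.
   [WY] stands for [U^Y] on the side of G and for [V^Y] on the side of H;
   [Qbas] is the calligraphic Q, [Qfac1] and [Qnew] are the plain Q_1, Q_j. *)
Record side (R : realType) (n k : nat) : Type := Side {
  rk : nat -> nat;
  trunc : nat -> nat;
  cnew : nat -> nat;
  dim_eq : forall j, (rk j.+1 + cnew j.+2 = rk j.+2 + trunc j.+2)%N;
  Perm1 : 'M[R]_(k + k);
  Qfac1 : 'M[R]_(n, rk 1 + trunc 1);
  Rfac1 : 'M[R]_(rk 1 + trunc 1, k + k);
  WY : forall j, 'M[R]_(svd_dim k rk j);
  Theta : forall j, 'M[R]_(rk j + trunc j);
  Sigma : forall j, 'M[R]_(rk j + trunc j);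
  Phi : forall j, 'M[R]_(phi_dim k rk j, rk j + trunc j);
  Qnew : forall j, 'M[R]_(n, cnew j);
  R12 : forall j, 'M[R]_(rk j);
  R2 : forall j, 'M[R]_(cnew j.+1, rk j);
  Qbas : forall j, 'M[R]_(n, rk j);
  Nmx : forall j, 'M[R]_(rk j, dbl k j)
}.

Section Side.
Variables (R : realType) (n k : nat) (s : side R n k).

Definition Theta1 j : 'M[R]_(rk s j + trunc s j, rk s j) := lsubmx (Theta s j).
Definition Sigma1 j : 'M[R]_(rk s j) := ulsubmx (Sigma s j).
Definition Sigma2 j : 'M[R]_(trunc s j) := drsubmx (Sigma s j).
Definition Phi1 j : 'M[R]_(phi_dim k (rk s) j, rk s j) := lsubmx (Phi s j).

(* The triangular factor of the QR factorization in the step [j+1 -> j+2],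
   with its number of rows read as [p_{j+2}]. *)
Definition Rblock j : 'M[R]_(rk s j.+2 + trunc s j.+2, rk s j.+1 + rk s j.+1) :=
  castmx (dim_eq s j, erefl) (block_mx 1%:M (R12 s j.+1) 0 (R2 s j.+1)).

Definition Mmx j : 'M[R]_(rk s j.+2 + trunc s j.+2, dbl k j.+2) :=
  Rblock j *m I2_kron (Nmx s j.+1).

Definition truncation (eps : nat -> R) j : Prop :=
  spectral_norm (Sigma2 j) <= eps j * spectral_norm (Sigma1 j).

(* Step 1, for the compound matrix [X = [X_0, X_1]] and [Ups = Upsilon_1]. *)
Record initial_step (X : 'M[R]_(n, k + k)) (Ups : 'M[R]_(k + k)) : Prop :=
  InitialStep {
  init_dim : (rk s 1 + trunc s 1 <= k + k)%N;
  init_perm : is_perm_mx (Perm1 s);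
  init_orth : orthonormal_cols (Qfac1 s);
  init_upper : upper_trapezoidal (Rfac1 s);
  init_qr : X *m (Perm1 s)^T = Qfac1 s *m Rfac1 s;
  init_svd : is_svd (Rfac1 s *m Perm1 s *m WY s 1 *m invmx (diag_sqrt Ups))
               (Theta s 1) (Sigma s 1) (Phi s 1);
  init_Qbas : Qbas s 1 = Qfac1 s *m Theta1 1;
  init_N : Nmx s 1 = (Theta1 1)^T *m Rfac1 s *m Perm1 s
}.

(* The step [j+1 -> j+2], with [At] the matrix whose powers are applied,
   [L = L_{j+1}] and [Ups = Upsilon_{j+2}]. *)
Record doubling_step (At : 'M[R]_n) j (L Ups : 'M[R]_(rk s j.+1)) : Prop :=
  DoublingStep {
  step_dim : (rk s j.+2 + trunc s j.+2 <= rk s j.+1 + rk s j.+1)%N;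
  step_orth : orthonormal_cols (row_mx (Qbas s j.+1) (Qnew s j.+2));
  step_upper : upper_trapezoidal (R2 s j.+1);
  step_qr : row_mx (Qbas s j.+1) (At ^+ (2 ^ j.+1) *m Qbas s j.+1) =
    row_mx (Qbas s j.+1) (Qnew s j.+2)
      *m block_mx 1%:M (R12 s j.+1) 0 (R2 s j.+1);
  step_svd : is_svd
    (Rblock j *m block_mx 1%:M (- L) 0 1%:M
       *m dsum (Sigma1 j.+1)
            (Sigma1 j.+1 *m WY s j.+2 *m invmx (diag_sqrt Ups)))
    (Theta s j.+2) (Sigma s j.+2) (Phi s j.+2);
  step_Qbas : Qbas s j.+2 =
    castmx (erefl, dim_eq s j) (row_mx (Qbas s j.+1) (Qnew s j.+2))
      *m Theta1 j.+2;
  step_N : Nmx s j.+2 = (Theta1 j.+2)^T *m Mmx j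
}.

End Side.

Section Doubling.
Variables (R : realType) (n m l : nat) (g : R).
Variables (sG : side R n m) (sH : side R n l).
Variable SY : forall j, 'M[R]_(svd_dim m (rk sG) j, svd_dim l (rk sH) j).
Variable Y : forall j, 'M[R]_(dbl m j, dbl l j).

Definition Omega j : 'M[R]_(rk sG j, rk sH j) := (Qbas sG j)^T *m Qbas sH j.

Definition UpsG1 : 'M[R]_(m + m) := 1%:M + SY 1 *m (SY 1)^T.
Definition UpsH1 : 'M[R]_(l + l) := 1%:M + (SY 1)^T *m SY 1.

(* [UpsG j] and [UpsH j] are [Upsilon_{j+2}]. *)
Definition UpsG j : 'M[R]_(rk sG j.+1) :=
  1%:M + (4 * g ^+ 2) *: (SY j.+2 *m (SY j.+2)^T).
Definition UpsH j : 'M[R]_(rk sH j.+1) :=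
  1%:M + (4 * g ^+ 2) *: ((SY j.+2)^T *m SY j.+2).

Definition LG j : 'M[R]_(rk sG j) :=
  (2 * g) *: (Nmx sG j *m invmx (1%:M + Y j *m (Y j)^T) *m Y j
                *m (Nmx sH j)^T *m (Omega j)^T).
Definition LH j : 'M[R]_(rk sH j) :=
  (2 * g) *: (Nmx sH j *m invmx (1%:M + (Y j)^T *m Y j) *m (Y j)^T
                *m (Nmx sG j)^T *m Omega j).

End Doubling.

Arguments LG {R n m l} g sG sH Y j.
Arguments LH {R n m l} g sG sH Y j.
Arguments UpsG1 {R n m l sG sH} SY.
Arguments UpsH1 {R n m l sG sH} SY.
Arguments UpsG {R n m l} g {sG sH} SY j.
Arguments UpsH {R n m l} g {sG sH} SY j.

Record truncated_doubling (R : realType) (n m l : nat) (A : 'M[R]_n)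
    (B : 'M[R]_(n, m)) (C : 'M[R]_(l, n)) (g : R) (eps : nat -> R)
    (sG : side R n m) (sH : side R n l)
    (SY : forall j, 'M[R]_(svd_dim m (rk sG) j, svd_dim l (rk sH) j))
    (Y : forall j, 'M[R]_(dbl m j, dbl l j)) : Prop := TruncatedDoubling {
  td_Y1 : Y 1 = block_mx 0 (Y0 A B C g) (Y0 A B C g) ((2 * g) *: T0 A B C g);
  td_svdY1 : is_svd (Y 1) (WY sG 1) (SY 1) (WY sH 1);
  td_initG : initial_step sG
    (row_mx (U0 A B g) (Atilde A g *m U0 A B g)) (UpsG1 SY);
  td_initH : initial_step sH
    (row_mx (V0 A C g) ((Atilde A g)^T *m V0 A C g)) (UpsH1 SY);
  td_truncG : forall j, truncation sG eps j.+1;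
  td_truncH : forall j, truncation sH eps j.+1;
  td_svdY : forall j,
    is_svd (Sigma1 sG j.+1 *m Omega sG sH j.+1 *m Sigma1 sH j.+1)
      (WY sG j.+2) (SY j.+2) (WY sH j.+2);
  td_stepG : forall j, doubling_step (Atilde A g)
    (LG g sG sH Y j.+1) (UpsG g SY j);
  td_stepH : forall j, doubling_step (Atilde A g)^T
    (LH g sG sH Y j.+1) (UpsH g SY j);
  td_Y : forall j, Y j.+2 =
    block_mx 0 (Y j.+1) (Y j.+1)
      ((2 * g) *: ((Nmx sG j.+1)^T *m Omega sG sH j.+1 *m Nmx sH j.+1))
}.

(* Main.v *)
Require Import Defs.
From HB Require Import structures.
From mathcomp Require Import all_boot all_order all_algebra.
From mathcomp Require Import reals.

Set Implicit Arguments.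
Unset Strict Implicit.
Unset Printing Implicit Defensive.
Import Order.TTheory GRing.Theory Num.Theory.
Local Open Scope ring_scope.

(** The theorem is a statement about one invariant.  For a matrix [Y], put
    [E = (1 + Y Y^T)^-1] and [F = (1 + Y^T Y)^-1]; the skew coupling
    [[1, Y; -Y^T, 1]] has inverse [[E, - E Y; Y^T E, F]].  The invariant
    [compresses Y N^G N^H Sigma^G Sigma^H K] says that compressing this inverse
    by [N^G (+) N^H] gives the core [[1, - K; K^T, 1]] framed by
    [Sigma^G (+) Sigma^H].  It holds at each step of the construction with
    [K = K_j^G]; its off-diagonal block is the formula for [L_j^G], and
    the formula for [L_j^H] is the transposed one.

    The invariant has two easy stability properties: multiplying the
    compressing matrices on the left multiplies the frames
    ([compresses_mull]), and a factor with orthonormal columns moves from the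
    frames into the core ([compresses_absorb]).  They account for the truncated
    SVDs, because dropping singular values is multiplication by
    [Theta_1^T], and [Theta_1^T Theta Sigma Phi^T = Sigma_1 Phi_1^T]
    ([svd_truncate]).

    What remains is the passage from [Y] to the doubled matrix
    [Y' = [0, Y; Y, W]] with [W = 2 gamma N^G^T Omega N^H].  The Schur
    complement of [1 + Y' Y'^T] is [E^-1 + W F W^T].  Since [N^H] enters
    [W F W^T] only through [N^H F N^H^T = Sigma^H Sigma^H^T], which the
    invariant knows, the compressed inverse of the Schur complement is
    [Sigma^G (1 + Gam Gam^T)^-1 Sigma^G^T] with
    [Gam = 2 gamma Sigma^G^T Omega Sigma^H].  The SVD of [Gam] factors
    [(1 + Gam Gam^T)^-1] as [Q Q^T] with [Q = U Upsilon^(-1/2)], which is where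
    the matrices of the next SVD and the blocks of [K] come from
    ([compresses_doubled]).  Step 1 is the same with [N = 1] and the SVD of
    [Y_1] ([compresses_init]). *)

(** * Inverses of Gram matrices shifted by the identity *)

Definition gram_inv (R : realType) (p q : nat) (Y : 'M[R]_(p, q)) : 'M[R]_p :=
  invmx (1%:M + Y *m Y^T).

Lemma trmxN (R : realType) (p q : nat) (M : 'M[R]_(p, q)) : (- M)^T = - M^T.
Proof. exact: linearN. Qed.

Lemma trmxZ (R : realType) (p q : nat) (c : R) (M : 'M[R]_(p, q)) :
  (c *: M)^T = c *: M^T.
Proof. exact: linearZ. Qed.

Section GramInverse.
Variables (R : realType) (p q : nat) (Y : 'M[R]_(p, q)).

Lemma mulmx_tr_ge0 (k : nat) (v : 'rV[R]_k) : 0 <= (v *m v^T) 0 0.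
Proof.
by rewrite mxE; apply: sumr_ge0 => i _; rewrite mxE -expr2 sqr_ge0.
Qed.

Lemma mulmx_tr_eq0 (k : nat) (v : 'rV[R]_k) : (v *m v^T) 0 0 = 0 -> v = 0.
Proof.
rewrite mxE => /eqP; rewrite psumr_eq0 => [|i _]; last first.
  by rewrite mxE -expr2 sqr_ge0.
move=> /allP v0; apply/rowP => i; have := v0 i (mem_index_enum _).
by rewrite /= !mxE mulf_eq0 orbb => /eqP.
Qed.

Lemma unitmx_gram : 1%:M + Y *m Y^T \in unitmx.
Proof.
rewrite -row_free_unit -kermx_eq0; apply/rowV0P => v /sub_kermxP v0.
apply: mulmx_tr_eq0; apply/eqP; rewrite eq_le mulmx_tr_ge0 andbT.
have : (v *m (1%:M + Y *m Y^T) *m v^T) 0 0 = 0 by rewrite v0 mul0mx mxE.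
rewrite mulmxDr mulmx1 mulmxDl mxE => /eqP; rewrite addr_eq0 => /eqP ->.
by rewrite oppr_le0 !mulmxA -mulmxA -trmx_mul mulmx_tr_ge0.
Qed.

Lemma gram_invK : gram_inv Y *m (1%:M + Y *m Y^T) = 1%:M.
Proof. exact: mulVmx unitmx_gram. Qed.

Lemma gram_inv_unique (r : nat) (a x : 'M[R]_(r, p)) :
  x *m (1%:M + Y *m Y^T) = a -> a *m gram_inv Y = x.
Proof. by move=> <-; rewrite mulmxK ?unitmx_gram. Qed.

Lemma gram_inv_sym : (gram_inv Y)^T = gram_inv Y.
Proof. by rewrite /gram_inv trmx_inv linearD /= trmx1 trmx_mul trmxK. Qed.

End GramInverse.

(** Divide [(1 + Y Y^T) Y = Y (1 + Y^T Y)] by the Gram matrix on each side. *)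
Lemma gram_inv_push (R : realType) (p q : nat) (Y : 'M[R]_(p, q)) :
  gram_inv Y *m Y = Y *m gram_inv Y^T.
Proof.
apply/esym/gram_inv_unique; rewrite -[RHS]mul1mx -(gram_invK Y) trmxK.
by rewrite -!mulmxA mulmxDr mulmxDl mulmx1 mul1mx mulmxA.
Qed.

(** This turns the difference [W W^T - W Y^T E Y W^T] left by a block
    elimination into [W F W^T]. *)
Lemma gram_inv_compl (R : realType) (p q : nat) (Y : 'M[R]_(p, q)) :
  1%:M - Y^T *m gram_inv Y *m Y = gram_inv Y^T.
Proof.
apply/eqP; rewrite subr_eq; apply/eqP.
rewrite -(mulmxV (unitmx_gram Y^T)).
by rewrite -mulmxA gram_inv_push mulmxA mulmxDl mul1mx -/(gram_inv Y^T) trmxK.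
Qed.

(** * Compressions of the inverse of a skew coupling *)

(** The three blocks of
    [(a (+) b) [1, Y; -Y^T, 1]^-1 (a (+) b)^T
       = (SG (+) SH) [1, - K; K^T, 1] (SG (+) SH)^T];
    the fourth block is the transpose of the third one, up to sign. *)
Definition compresses (R : realType) (p q r s r' s' : nat) (Y : 'M[R]_(p, q))
    (a : 'M[R]_(r, p)) (b : 'M[R]_(s, q))
    (SG : 'M[R]_(r, r')) (SH : 'M[R]_(s, s')) (K : 'M[R]_(r', s')) : Prop :=
  [/\ a *m gram_inv Y *m a^T = SG *m SG^T,
      b *m gram_inv Y^T *m b^T = SH *m SH^T
    & a *m gram_inv Y *m Y *m b^T = SG *m K *m SH^T].

Section Compression.
Variable (R : realType).

Lemma compresses_tr p q r s r' s' (Y : 'M[R]_(p, q))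
    (a : 'M[R]_(r, p)) (b : 'M[R]_(s, q))
    (SG : 'M[R]_(r, r')) (SH : 'M[R]_(s, s')) K :
  compresses Y a b SG SH K -> compresses Y^T b a SH SG K^T.
Proof.
case=> Ea Eb Ec; split=> //; first by rewrite trmxK.
have := congr1 trmx Ec; rewrite !trmx_mul !trmxK gram_inv_sym !mulmxA => <-.
by rewrite -[_ *m Y^T]mulmxA gram_inv_push trmxK !mulmxA.
Qed.

Lemma compresses_mull p q r s r' s' r1 s1 (Y : 'M[R]_(p, q))
    (a : 'M[R]_(r, p)) (b : 'M[R]_(s, q))
    (SG : 'M[R]_(r, r')) (SH : 'M[R]_(s, s')) K
    (c : 'M[R]_(r1, r)) (d : 'M[R]_(s1, s)) :
  compresses Y a b SG SH K ->
  compresses Y (c *m a) (d *m b) (c *m SG) (d *m SH) K.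
Proof.
case=> Ea Eb Ec; split; rewrite !trmx_mul.
- transitivity (c *m (a *m gram_inv Y *m a^T) *m c^T);
    first by rewrite !mulmxA.
  by rewrite Ea !mulmxA.
- transitivity (d *m (b *m gram_inv Y^T *m b^T) *m d^T);
    first by rewrite !mulmxA.
  by rewrite Eb !mulmxA.
- transitivity (c *m (a *m gram_inv Y *m Y *m b^T) *m d^T);
    first by rewrite !mulmxA.
  by rewrite Ec !mulmxA.
Qed.

(** Orthonormality is needed for the diagonal blocks, where the factor must
    cancel; in the off-diagonal block it just moves into the core. *)
Lemma compresses_absorb p q r s r' s' r1 s1 (Y : 'M[R]_(p, q))
    (a : 'M[R]_(r, p)) (b : 'M[R]_(s, q))
    (SG : 'M[R]_(r, r')) (SH : 'M[R]_(s, s')) K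
    (PG : 'M[R]_(r1, r')) (PH : 'M[R]_(s1, s')) :
  orthonormal_cols PG -> orthonormal_cols PH ->
  compresses Y a b (SG *m PG^T) (SH *m PH^T) K ->
  compresses Y a b SG SH (PG^T *m K *m PH).
Proof.
rewrite /orthonormal_cols => oG oH [Ea Eb Ec]; split.
- by rewrite Ea trmx_mul trmxK mulmxA -[_ *m PG]mulmxA oG mulmx1.
- by rewrite Eb trmx_mul trmxK mulmxA -[_ *m PH]mulmxA oH mulmx1.
- by rewrite Ec trmx_mul trmxK !mulmxA.
Qed.

End Compression.

(** * The effect of doubling *)

Section Doubling.
Variables (R : realType) (p q r s r' s' : nat).
Variables (Y : 'M[R]_(p, q)) (a : 'M[R]_(r, p)) (b : 'M[R]_(s, q)).
Variables (SG : 'M[R]_(r, r')) (SH : 'M[R]_(s, s')) (K : 'M[R]_(r', s')).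
Variable Om : 'M[R]_(r, s).

Definition doubled : 'M[R]_(p + p, q + q) := block_mx 0 Y Y (a^T *m Om *m b).

(** Eliminating the off-diagonal block of [1 + Y' Y'^T], where [Y'] is
    [doubled] and [W] its corner, couples the two copies of [a] through
    [a E Y W^T].  As [W^T] ends with [a], this coupling is [L a] with
    [L = a E Y b^T Om^T], so the elimination survives compression as a shear by
    [L]; for [Om = 2 gamma Omega] this is [L^G]. *)
Definition shear : 'M[R]_(r + r) :=
  block_mx 1%:M (- (a *m gram_inv Y *m Y *m b^T *m Om^T)) 0 1%:M.

Variable T : 'M[R]_r'.
Let Gam : 'M[R]_(r', s') := SG^T *m Om *m SH.
Hypothesis cY : compresses Y a b SG SH K.
Hypothesis TK : T *m (1%:M + Gam *m Gam^T) = 1%:M.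

(** This is [a S^-1], where [S] is the Schur complement
    [1 + Y Y^T + W F W^T]: the formula is the Woodbury identity, rewritten with
    the compressions of [E] and [F], so that [S] itself is never inverted. *)
Definition schur_row : 'M[R]_(r, p) :=
  (1%:M - SG *m T *m Gam *m SH^T *m Om^T) *m a *m gram_inv Y.

Let W : 'M[R]_(p, q) := a^T *m Om *m b.

Lemma schur_rowK :
  schur_row *m (1%:M + Y *m Y^T + W *m gram_inv Y^T *m W^T) = a.
Proof.
case: cY => Ea Eb Ec; rewrite mulmxDr /schur_row mulmxKV ?unitmx_gram //.
set N := SG *m T *m _ *m _ *m _.
have -> : (1%:M - N) *m a *m gram_inv Y *m (W *m gram_inv Y^T *m W^T) =
    (1%:M - N) *m (SG *m Gam *m SH^T *m Om^T *m a).
  rewrite /W /Gam !trmx_mul trmxK.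
  rewrite [RHS](_ : _ = (1%:M - N) *m (SG *m SG^T) *m Om *m (SH *m SH^T)
                       *m Om^T *m a); last by rewrite !mulmxA.
  by rewrite -Ea -Eb !mulmxA.
rewrite -mulmxDr.
have -> : a + SG *m Gam *m SH^T *m Om^T *m a =
    (1%:M + SG *m Gam *m SH^T *m Om^T) *m a by rewrite mulmxDl mul1mx.
rewrite mulmxA -[RHS]mul1mx; congr (_ *m _).
rewrite mulmxBl mul1mx mulmxDr mulmx1 -addrA.
have -> : N *m (SG *m Gam *m SH^T *m Om^T) =
    SG *m (T *m (Gam *m Gam^T)) *m Gam *m SH^T *m Om^T.
  by rewrite /N /Gam !trmx_mul !trmxK !mulmxA.
have -> : T *m (Gam *m Gam^T) = 1%:M - T.
  by rewrite -TK mulmxDr mulmx1 addrC addKr.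
rewrite mulmxBr mulmx1 !mulmxBl /N.
by rewrite [X in _ - X]addrC subrK subrr addr0.
Qed.

Lemma schur_row_tr : schur_row *m a^T = SG *m T *m SG^T.
Proof.
case: cY => Ea Eb Ec; rewrite /schur_row.
transitivity ((1%:M - SG *m T *m Gam *m SH^T *m Om^T)
                *m (a *m gram_inv Y *m a^T)); first by rewrite !mulmxA.
rewrite Ea mulmxBl mul1mx.
have -> : SG *m T *m Gam *m SH^T *m Om^T *m (SG *m SG^T) =
    SG *m (T *m (Gam *m Gam^T)) *m SG^T.
  by rewrite /Gam !trmx_mul !trmxK !mulmxA.
have -> : T *m (Gam *m Gam^T) = 1%:M - T.
  by rewrite -TK mulmxDr mulmx1 addrC addKr.
by rewrite mulmxBr mulmx1 mulmxBl opprB addrC subrK.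
Qed.

(** The zero block of [Y'] makes the block factor on the right-hand side times
    [1 + Y' Y'^T] equal to [[a, a E Y W^T; 0, a]], which the shear reduces to
    [I2_kron a]. *)
Lemma doubled_gram_inv :
  I2_kron a *m gram_inv doubled =
  shear *m block_mx (a *m gram_inv Y) 0
             (- (schur_row *m W *m Y^T *m gram_inv Y)) schur_row.
Proof.
case: cY => Ea Eb Ec; apply: gram_inv_unique.
rewrite -mulmxA.
have -> : block_mx (a *m gram_inv Y) 0
             (- (schur_row *m W *m Y^T *m gram_inv Y)) schur_row
          *m (1%:M + doubled *m doubled^T) =
  block_mx a (a *m gram_inv Y *m Y *m W^T) 0 a.
  rewrite /doubled tr_block_mx trmx0 mulmx_block !mul0mx mulmx0 add0r -/W.
  rewrite scalar_mx_block add_block_mx !add0r addrA mulmx_block !mul0mx !addr0.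
  rewrite mulmxKV ?unitmx_gram //; congr block_mx; first by rewrite mulmxA.
    by rewrite mulNmx mulmxKV ?unitmx_gram // -mulmxA addNr.
  have WFW : W *m gram_inv Y^T *m W^T =
      W *m W^T - W *m Y^T *m gram_inv Y *m (Y *m W^T).
    by rewrite -gram_inv_compl mulmxBr mulmx1 mulmxBl !mulmxA.
  rewrite -[RHS]schur_rowK WFW mulNmx !mulmxDr mulmxN !mulmxA.
  by rewrite addrC [RHS]addrA.
rewrite /shear mulmx_block !mul1mx !mul0mx mulmx0 !addr0 !add0r.
congr block_mx; rewrite mulNmx; apply/eqP; rewrite subr_eq0; apply/eqP.
by rewrite /W !trmx_mul trmxK !mulmxA.
Qed.

Lemma shearE : shear = block_mx 1%:M (- (SG *m K *m SH^T *m Om^T)) 0 1%:M.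
Proof. by case: cY => _ _ Ec; rewrite /shear Ec. Qed.

(** The block [- schur_row W Y^T E a^T] on the lower left of the compressed
    inverse equals [- (schur_row a^T) L^T] because [W] starts with [a^T Om b]
    and [b Y^T E a^T] is the transposed off-diagonal compression.  Hence a
    transposed shear factors out on the right. *)
Lemma doubled_gram_compression (QG : 'M[R]_r') :
  T = QG *m QG^T ->
  let D := shear *m dsum SG (SG *m QG) in
  I2_kron a *m gram_inv doubled *m (I2_kron a)^T = D *m D^T.
Proof.
move=> TE D; case: (cY) => Ea Eb Ec.
rewrite doubled_gram_inv -mulmxA /D trmx_mul -[RHS]mulmxA; congr (_ *m _).
rewrite shearE /I2_kron /dsum !tr_block_mx !trmx0 !trmx1 !mulmx_block.
rewrite !(mul0mx, mulmx0, mulmx1, add0r, addr0) Ea schur_row_tr.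
congr block_mx; last by rewrite TE trmx_mul !mulmxA.
have -> : - (schur_row *m W *m Y^T *m gram_inv Y) *m a^T =
    - (schur_row *m a^T *m Om *m (b *m Y^T *m gram_inv Y *m a^T)).
  by rewrite mulNmx /W !mulmxA.
have -> : b *m Y^T *m gram_inv Y *m a^T = SH *m K^T *m SG^T.
  have := congr1 trmx Ec; rewrite !trmx_mul !trmxK gram_inv_sym !mulmxA.
  by move=> ->.
rewrite schur_row_tr trmxN !trmx_mul !trmxK TE !mulmxN.
by congr (- _); rewrite !mulmxA.
Qed.

End Doubling.

Lemma doubled_tr (R : realType) p q r s (Y : 'M[R]_(p, q)) (a : 'M[R]_(r, p))
    (b : 'M[R]_(s, q)) (Om : 'M[R]_(r, s)) :
  (doubled Y a b Om)^T = doubled Y^T b a Om^T.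
Proof. by rewrite /doubled tr_block_mx trmx0 !trmx_mul trmxK mulmxA. Qed.

(** The matrix [QG] is a square root of [(1 + Gam Gam^T)^-1], [QH] the same for
    [Gam^T], and the last condition says that [S] is [QG^T Gam QH^-T]; when the
    square roots come from an SVD of [Gam], this is its diagonal factor.
    The diagonal blocks are [doubled_gram_compression] on the two sides.  In
    the off-diagonal block, [doubled] has a zero corner, whereas the shear on
    the right produces [- K Gam^T K]: the corner [K Gam^T K] of the core
    compensates it. *)
Lemma compresses_doubled (R : realType) p q r s r' s' (Y : 'M[R]_(p, q))
    (a : 'M[R]_(r, p)) (b : 'M[R]_(s, q)) (SG : 'M[R]_(r, r'))
    (SH : 'M[R]_(s, s')) (K : 'M[R]_(r', s')) (Om : 'M[R]_(r, s))
    (QG QGi : 'M[R]_r') (QH QHi : 'M[R]_s') (S : 'M[R]_(r', s')) :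
  let Gam := SG^T *m Om *m SH in
  compresses Y a b SG SH K ->
  QG *m QG^T *m (1%:M + Gam *m Gam^T) = 1%:M ->
  QH *m QH^T *m (1%:M + Gam^T *m Gam) = 1%:M ->
  QG *m QGi = 1%:M -> QH *m QHi = 1%:M ->
  QG *m S *m QH^T = QG *m QG^T *m Gam ->
  compresses (doubled Y a b Om) (I2_kron a) (I2_kron b)
    (shear Y a b Om *m dsum SG (SG *m QG))
    (shear Y^T b a Om^T *m dsum SH (SH *m QH))
    (block_mx (K *m Gam^T *m K) (K *m QHi^T) (QGi *m K) S).
Proof.
move=> Gam cY TG TH QGK QHK SE.
have cYt := compresses_tr cY.
have GamT : SH^T *m Om^T *m SG = Gam^T by rewrite /Gam !trmx_mul trmxK mulmxA.
have THt : QH *m QH^T *m (1%:M + SH^T *m Om^T *m SG *m (SH^T *m Om^T *m SG)^T)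
    = 1%:M by rewrite GamT trmxK.
split.
- exact: (doubled_gram_compression cY TG).
- by rewrite doubled_tr; apply: (doubled_gram_compression cYt THt).
case: (cY) => Ea Eb Ec.
have QHt : QHi^T *m QH^T = 1%:M by rewrite -trmx_mul QHK trmx1.
rewrite (doubled_gram_inv cY TG).
set J := shear Y a b Om; set c := schur_row _ _ _ _ _ _.
set W := a^T *m Om *m b.
have ca : c *m a^T = SG *m (QG *m QG^T) *m SG^T := schur_row_tr cY TG.
have -> : shear Y^T b a Om^T =
    block_mx 1%:M (- (SH *m K^T *m SG^T *m Om)) 0 1%:M.
  by rewrite (shearE _ cYt) trmxK.
rewrite -3!mulmxA -[in RHS](mulmxA J) -[in RHS](mulmxA J); congr (J *m _).
rewrite /dsum /I2_kron /doubled -/W.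
rewrite !trmx_mul !tr_block_mx !trmx0 !trmx1 !mulmx_block.
rewrite !(mul0mx, mulmx0, mul1mx, mulmx1, add0r, addr0).
rewrite !trmxN !trmx_mul !trmxK !mulmxN.
congr block_mx.
- by rewrite !mulmxA -[SG *m K *m QHi^T *m QH^T]mulmxA QHt mulmx1 subrr.
- by rewrite !mulmxA -[SG *m K *m QHi^T *m QH^T]mulmxA QHt mulmx1.
- transitivity ((1%:M - SG *m (QG *m QG^T *m Gam) *m SH^T *m Om^T)
                  *m (a *m gram_inv Y *m Y *m b^T)).
    by rewrite /c /schur_row /Gam !mulmxA.
  rewrite Ec mulmxBl mul1mx -SE !mulmxA.
  by rewrite -[SG *m QG *m QGi]mulmxA QGK mulmx1.
transitivity (c *m W *m gram_inv Y^T *m b^T).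
  rewrite -[gram_inv Y^T]gram_inv_compl mulmxBr mulmx1 mulmxBl addrC mulNmx.
  by rewrite !mulmxA.
transitivity (c *m a^T *m Om *m (b *m gram_inv Y^T *m b^T)).
  by rewrite /W !mulmxA.
rewrite ca Eb.
transitivity (SG *m (QG *m QG^T *m Gam) *m SH^T); first by rewrite /Gam !mulmxA.
by rewrite -SE !mulmxA.
Qed.

(** * Square roots from singular value decompositions *)

Section GramSquareRoot.
Variables (R : realType) (r s : nat).

Lemma trmx_is_diag (S : 'M[R]_(r, s)) : is_diag_mx S -> is_diag_mx S^T.
Proof.
move=> /is_diag_mxP dS; apply/is_diag_mxP => i j nij; rewrite mxE dS //.
by rewrite eq_sym.
Qed.

Lemma gram_diagE (S : 'M[R]_(r, s)) (i : 'I_r) (j : 'I_s) :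
  is_diag_mx S -> i = j :> nat -> (1%:M + S *m S^T) i i = 1 + S i j ^+ 2.
Proof.
move=> /is_diag_mxP dS ij; rewrite !mxE eqxx (bigD1 j) //= mxE big1 ?addr0 //.
by move=> k nkj; rewrite dS ?mul0r // ij eq_sym.
Qed.

Lemma gram_is_diag (S : 'M[R]_(r, s)) :
  is_diag_mx S -> is_diag_mx (1%:M + S *m S^T).
Proof.
move=> /is_diag_mxP dS; apply/is_diag_mxP => i j nij; rewrite !mxE.
rewrite -val_eqE (negbTE nij) add0r big1 // => k _; rewrite mxE.
case: (eqVneq (i : nat) k) => [ik|/dS->]; last by rewrite mul0r.
by rewrite (dS j) ?mulr0 // -ik eq_sym.
Qed.

Lemma gram_diag_ge0 (S : 'M[R]_(r, s)) i : 0 <= (1%:M + S *m S^T) i i.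
Proof.
rewrite !mxE eqxx addr_ge0 ?ler01 //; apply: sumr_ge0 => k _.
by rewrite mxE -expr2 sqr_ge0.
Qed.

Lemma gram_sqrtK (S : 'M[R]_(r, s)) : is_diag_mx S ->
  diag_sqrt (1%:M + S *m S^T) *m diag_sqrt (1%:M + S *m S^T) = 1%:M + S *m S^T.
Proof.
by move=> dS; apply: diag_sqrtK; [apply: gram_is_diag|apply: gram_diag_ge0].
Qed.

Lemma gram_sqrt_unit (S : 'M[R]_(r, s)) : is_diag_mx S ->
  diag_sqrt (1%:M + S *m S^T) \in unitmx.
Proof.
move=> dS; move: (unitmx_gram S).
by rewrite -{1}(gram_sqrtK dS) unitmx_mul andbb.
Qed.

End GramSquareRoot.

Lemma gram_sqrt_comm (R : realType) (r s : nat) (S : 'M[R]_(r, s)) :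
  is_diag_mx S ->
  diag_sqrt (1%:M + S *m S^T) *m S = S *m diag_sqrt (1%:M + S^T *m S).
Proof.
move=> dS; rewrite /diag_sqrt mul_diag_mx mul_mx_diag.
apply/matrixP => i j; rewrite mxE [RHS]mxE mulrC.
case: (eqVneq (i : nat) j) => [ij|nij]; last first.
  by have /is_diag_mxP -> := dS; rewrite ?mul0r.
congr (_ * _); rewrite mxE [RHS]mxE (gram_diagE dS ij); congr Num.sqrt.
have := gram_diagE (trmx_is_diag dS) (esym ij).
by rewrite trmxK => ->; rewrite mxE.
Qed.

Section Whitening.
Variables (R : realType) (r s : nat) (U : 'M[R]_r) (S : 'M[R]_(r, s)).
Variable V : 'M[R]_s.
Hypotheses (oU : orthonormal_cols U) (oV : orthonormal_cols V).
Hypothesis dS : is_diag_mx S.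
Let Gam := U *m S *m V^T.
Let hG := diag_sqrt (1%:M + S *m S^T).
Let hH := diag_sqrt (1%:M + S^T *m S).

Lemma whitener_gram : (U *m invmx hG) *m (U *m invmx hG)^T =
  U *m invmx (1%:M + S *m S^T) *m U^T.
Proof.
have symh : (invmx hG)^T = invmx hG by rewrite trmx_inv tr_diag_mx.
rewrite trmx_mul symh -(gram_sqrtK dS) -/hG.
have uh : hG \in unitmx by apply: gram_sqrt_unit.
have -> : invmx (hG *m hG) = invmx hG *m invmx hG.
  have hK : invmx hG *m invmx hG *m (hG *m hG) = 1%:M.
    by rewrite mulmxA mulmxKV // mulVmx.
  by rewrite -[LHS]mul1mx -hK mulmxK // unitmx_mul uh.
by rewrite !mulmxA.
Qed.

(** In the basis [U], the matrix [1 + Gam Gam^T] is diagonal and equal to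
    [hG^2], so it is whitened by [U hG^-1]. *)
Lemma whitener_inv :
  (U *m invmx hG) *m (U *m invmx hG)^T *m (1%:M + Gam *m Gam^T) = 1%:M.
Proof.
have UU : U *m U^T = 1%:M by apply: mulmx1C.
rewrite whitener_gram.
have -> : 1%:M + Gam *m Gam^T = U *m (1%:M + S *m S^T) *m U^T.
  rewrite mulmxDr mulmx1 mulmxDl UU; congr (_ + _).
  rewrite /Gam !trmx_mul trmxK !mulmxA -[_ *m V^T *m V]mulmxA.
  by rewrite (oV : V^T *m V = 1%:M) mulmx1.
rewrite !mulmxA -[_ *m U^T *m U]mulmxA (oU : U^T *m U = 1%:M) mulmx1.
by rewrite mulmxKV ?unitmx_gram.
Qed.

Lemma whitenerK : (U *m invmx hG) *m (hG *m U^T) = 1%:M.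
Proof.
rewrite mulmxA mulmxKV; last exact: gram_sqrt_unit.
exact: mulmx1C.
Qed.

(** It comes down to [hG^-1 S = S hH^-1], which holds because [S] is diagonal
    and its rows and columns are scaled by the same numbers
    [(1 + s_i^2)^(1/2)]. *)
Lemma whitener_sv : (U *m invmx hG) *m S *m (V *m invmx hH)^T =
  (U *m invmx hG) *m (U *m invmx hG)^T *m Gam.
Proof.
have uh : hG \in unitmx by apply: gram_sqrt_unit.
have uH : hH \in unitmx.
  by have := gram_sqrt_unit (trmx_is_diag dS); rewrite trmxK.
have comm : invmx hG *m S = S *m invmx hH.
  apply: (can_inj (mulKmx uh)); rewrite mulmxA mulmxV // mul1mx mulmxA.
  by rewrite gram_sqrt_comm // mulmxK.
have symh : (invmx hH)^T = invmx hH by rewrite trmx_inv tr_diag_mx.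
have symg : (invmx hG)^T = invmx hG by rewrite trmx_inv tr_diag_mx.
rewrite !trmx_mul symh symg /Gam !mulmxA -[_ *m U^T *m U]mulmxA.
rewrite (oU : U^T *m U = 1%:M) mulmx1; congr (_ *m _).
by rewrite -2!mulmxA -comm !mulmxA.
Qed.

End Whitening.

(** With nothing compressed, [E] and [F] are [Q Q^T] for the whitening factors
    [Q] of the two sides, and [E Y] is diagonalized along with [Y]. *)
Lemma compresses_init (R : realType) (p q : nat) (Y S : 'M[R]_(p, q)) U V :
  orthonormal_cols U -> orthonormal_cols V -> is_diag_mx S ->
  Y = U *m S *m V^T ->
  compresses Y 1%:M 1%:M (U *m invmx (diag_sqrt (1%:M + S *m S^T)))
    (V *m invmx (diag_sqrt (1%:M + S^T *m S))) S.
Proof.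
move=> oU oV dS YE.
have gY : gram_inv Y = (U *m invmx (diag_sqrt (1%:M + S *m S^T))) *m
    (U *m invmx (diag_sqrt (1%:M + S *m S^T)))^T.
  by rewrite -[LHS]mul1mx; apply: gram_inv_unique; rewrite YE whitener_inv.
have YtE : Y^T = V *m S^T *m U^T by rewrite YE !trmx_mul trmxK mulmxA.
have := whitener_inv oV oU (trmx_is_diag dS); rewrite -YtE trmxK => invH.
split; rewrite ?trmx1 ?mul1mx ?mulmx1 //.
- by rewrite -[LHS]mul1mx; apply: gram_inv_unique; rewrite invH.
- by rewrite gY whitener_sv // YE.
Qed.

(** * Truncation on one side of the construction *)

(** Since [Sg] is diagonal, the retained columns of [Th] meet only the retained
    singular values, so [Th_1^T] performs the truncation exactly. *)
Lemma svd_truncate (R : realType) (n r t : nat) (M : 'M[R]_(r + t, n))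
    (Th Sg : 'M[R]_(r + t)) (Ph : 'M[R]_(n, r + t)) :
  is_svd M Th Sg Ph ->
  (lsubmx Th)^T *m M = ulsubmx Sg *m (lsubmx Ph)^T.
Proof.
case=> oTh [/is_diag_mxP dS _ _] _ ->.
rewrite trmx_lsub mul_usub_mx !mulmxA (oTh : Th^T *m Th = 1%:M) mul1mx.
rewrite -[Sg in LHS]submxK -[in LHS](hsubmxK Ph) tr_row_mx mul_block_col.
have -> : ursubmx Sg = 0.
  apply/matrixP => i j; rewrite !mxE dS //= neq_ltn.
  by rewrite (leq_trans (ltn_ord i)) ?leq_addr.
by rewrite mul0mx addr0 col_mxKu.
Qed.

Lemma svd_ulsub_sym (R : realType) (r t : nat) (Sg : 'M[R]_(r + t)) :
  is_diag_mx Sg -> (ulsubmx Sg)^T = ulsubmx Sg.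
Proof.
move=> /is_diag_mxP dS; apply/matrixP => i j; rewrite !mxE.
by case: (eqVneq i j) => [->//|nij]; rewrite !dS // /= eq_sym.
Qed.

Lemma lsub_orthonormal (R : realType) (n r t : nat) (Ph : 'M[R]_(n, r + t)) :
  orthonormal_cols Ph -> orthonormal_cols (lsubmx Ph).
Proof.
rewrite /orthonormal_cols -{1 2}(hsubmxK Ph) tr_row_mx mul_col_row.
by rewrite scalar_mx_block => /eq_block_mx[].
Qed.

Section OneSide.
Variables (R : realType) (n k : nat) (sd : side R n k).

Lemma svd_Sigma1_sym j M :
  is_svd M (Theta sd j) (Sigma sd j) (Phi sd j) ->
  (Sigma1 sd j)^T = Sigma1 sd j.
Proof. by case=> _ [dS _ _] _ _; apply: svd_ulsub_sym. Qed.

Lemma svd_Phi1_orthonormal j M :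
  is_svd M (Theta sd j) (Sigma sd j) (Phi sd j) ->
  orthonormal_cols (Phi1 sd j).
Proof. by case=> _ _ oP _; apply: lsub_orthonormal. Qed.

Lemma initial_compress X Ups : initial_step sd X Ups ->
  Nmx sd 1 *m (WY sd 1 *m invmx (diag_sqrt Ups)) =
  Sigma1 sd 1 *m (Phi1 sd 1)^T.
Proof.
move=> st; rewrite (init_N st) -(svd_truncate (init_svd st)).
by rewrite /Theta1 !mulmxA.
Qed.

(** The factor framing the doubled invariant, compressed once more by
    [Theta_1^T], is exactly the matrix whose truncated SVD is computed. *)
Lemma doubling_compress At j L Ups : doubling_step At L Ups ->
  (Theta1 sd j.+2)^T *m Rblock sd j
    *m (block_mx 1%:M (- L) 0 1%:M
        *m dsum (Sigma1 sd j.+1)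
             (Sigma1 sd j.+1 *m (WY sd j.+2 *m invmx (diag_sqrt Ups)))) =
  Sigma1 sd j.+2 *m (Phi1 sd j.+2)^T.
Proof.
move=> st; rewrite -(svd_truncate (step_svd st)).
by rewrite /Theta1 !mulmxA.
Qed.

End OneSide.

Lemma gram_scale (R : realType) (p q : nat) (g : R) (S : 'M[R]_(p, q)) :
  1%:M + (4 * g ^+ 2) *: (S *m S^T) =
  1%:M + ((2 * g) *: S) *m ((2 * g) *: S)^T.
Proof.
rewrite trmxZ -scalemxAl -scalemxAr scalerA; congr (_ + _ *: _).
by rewrite -expr2 exprMn -natrX.
Qed.

Theorem lemma3p3 (R : realType) (n m l : nat) (A : 'M[R]_n)
    (B : 'M[R]_(n, m)) (C : 'M[R]_(l, n)) (g : R) (eps : nat -> R)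
    (sG : side R n m) (sH : side R n l)
    (SY : forall j, 'M[R]_(svd_dim m (rk sG) j, svd_dim l (rk sH) j))
    (Y : forall j, 'M[R]_(dbl m j, dbl l j))
    (KG : forall j, 'M[R]_(rk sG j, rk sH j))
    (KH : forall j, 'M[R]_(rk sH j, rk sG j))
    (rankB : \rank B = m) (rankC : \rank C^T = l)
    (stabAB : stabilizable A B) (detAC : detectable A C)
    (g_gt0 : 0 < g)
    (Ag_unit : Ashift A g \in unitmx) (Kg_unit : Kshift A B C g \in unitmx)
    (eps_ge0 : forall j, 0 <= eps j.+1)
    (td : truncated_doubling A B C g eps SY Y)
    (KG1 : KG 1%N = (Phi1 sG 1)^T *m SY 1%N *m Phi1 sH 1)
    (KGS : forall j, KG j.+2 =
       (Phi1 sG j.+2)^T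
         *m block_mx
              ((2 * g) *: (KG j.+1 *m Sigma1 sH j.+1 *m (Omega sG sH j.+1)^T
                             *m Sigma1 sG j.+1 *m KG j.+1))
              (KG j.+1 *m WY sH j.+2 *m diag_sqrt (UpsH g SY j))
              (diag_sqrt (UpsG g SY j) *m (WY sG j.+2)^T *m KG j.+1)
              ((2 * g) *: SY j.+2)
         *m Phi1 sH j.+2)
    (KHE : forall j, KH j.+1 = (KG j.+1)^T) :
  forall j,
    [/\ LG g sG sH Y j.+2 =
          (2 * g) *: (Sigma1 sG j.+2 *m KG j.+2 *m Sigma1 sH j.+2
                        *m (Omega sG sH j.+2)^T),
        LH g sG sH Y j.+2 =
          (2 * g) *: (Sigma1 sH j.+2 *m KH j.+2 *m Sigma1 sG j.+2
                        *m Omega sG sH j.+2)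
      & KG j.+2 =
          (Phi1 sG j.+2)^T
            *m dsum (KG j.+1) (1%:M : 'M[R]_(rk sG j.+1))
            *m block_mx
                 ((2 * g) *: (WY sH j.+2 *m (SY j.+2)^T *m (WY sG j.+2)^T))
                 (WY sH j.+2 *m diag_sqrt (UpsH g SY j))
                 (diag_sqrt (UpsG g SY j) *m (WY sG j.+2)^T)
                 ((2 * g) *: SY j.+2)
            *m dsum (KG j.+1) (1%:M : 'M[R]_(rk sH j.+1))
            *m Phi1 sH j.+2].
Proof.
have [_ svdY1 iG iH _ _ svdY stG stH Ydbl] := td.
have symG j : (Sigma1 sG j.+1)^T = Sigma1 sG j.+1.
  case: j => [|j]; first exact: svd_Sigma1_sym (init_svd iG).
  exact: svd_Sigma1_sym (step_svd (stG j)).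
have symH j : (Sigma1 sH j.+1)^T = Sigma1 sH j.+1.
  case: j => [|j]; first exact: svd_Sigma1_sym (init_svd iH).
  exact: svd_Sigma1_sym (step_svd (stH j)).
have svd_tr j : Sigma1 sH j.+1 *m (Omega sG sH j.+1)^T *m Sigma1 sG j.+1 =
    WY sH j.+2 *m (SY j.+2)^T *m (WY sG j.+2)^T.
  case: (svdY j) => _ _ _ GE; apply: trmx_inj.
  rewrite trmx_mul trmx_mul trmxK symG symH mulmxA GE.
  by rewrite !trmx_mul !trmxK mulmxA.
have inv j : compresses (Y j.+1) (Nmx sG j.+1) (Nmx sH j.+1)
    (Sigma1 sG j.+1) (Sigma1 sH j.+1) (KG j.+1).
  elim: j => [|j IHj].
    rewrite KG1; apply: compresses_absorb.
    - exact: svd_Phi1_orthonormal (init_svd iG).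
    - exact: svd_Phi1_orthonormal (init_svd iH).
    case: svdY1 => oU [dS _ _] oV YE.
    have := compresses_mull (Nmx sG 1) (Nmx sH 1) (compresses_init oU oV dS YE).
    by rewrite !mulmx1 (initial_compress iG) (initial_compress iH).
  rewrite KGS; apply: compresses_absorb.
  - exact: svd_Phi1_orthonormal (step_svd (stG j)).
  - exact: svd_Phi1_orthonormal (step_svd (stH j)).
  rewrite -(doubling_compress (stG j)) -(doubling_compress (stH j)).
  rewrite (step_N (stG j)) (step_N (stH j)) /Mmx !(mulmxA (Theta1 _ _)^T).
  apply: compresses_mull.
  (* The factor 2 gamma goes into [Omega] and into the singular values. *)
  set U := WY sG j.+2; set V := WY sH j.+2.
  pose S := (2 * g) *: SY j.+2; pose Om := (2 * g) *: Omega sG sH j.+1.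
  have UG : UpsG g SY j = 1%:M + S *m S^T by apply: gram_scale.
  have UH : UpsH g SY j = 1%:M + S^T *m S.
    by have := gram_scale g (SY j.+2)^T; rewrite /S !trmxZ trmxK.
  have [oU [/is_diag_mxP dSY _ _] oV GE] := svdY j.
  have dS : is_diag_mx S.
    by apply/is_diag_mxP => i k ik; rewrite mxE dSY ?mulr0.
  have GamE : (Sigma1 sG j.+1)^T *m Om *m Sigma1 sH j.+1 = U *m S *m V^T.
    by rewrite symG /Om /S -!scalemxAr -!scalemxAl GE.
  have YE : Y j.+2 = doubled (Y j.+1) (Nmx sG j.+1) (Nmx sH j.+1) Om.
    by rewrite Ydbl /doubled /Om -scalemxAr -scalemxAl.
  have LGE : block_mx 1%:M (- LG g sG sH Y j.+1) 0 1%:M =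
      shear (Y j.+1) (Nmx sG j.+1) (Nmx sH j.+1) Om.
    by rewrite /shear /LG /Om trmxZ -scalemxAr.
  have LHE : block_mx 1%:M (- LH g sG sH Y j.+1) 0 1%:M =
      shear (Y j.+1)^T (Nmx sH j.+1) (Nmx sG j.+1) Om^T.
    by rewrite /shear /LH /Om trmxK -scalemxAr /gram_inv trmxK.
  rewrite YE LGE LHE UG UH.
  have trGam : (U *m S *m V^T)^T = V *m S^T *m U^T.
    by rewrite !trmx_mul trmxK mulmxA.
  have trGamZ : (U *m S *m V^T)^T =
      (2 * g) *: (Sigma1 sH j.+1 *m (Omega sG sH j.+1)^T *m Sigma1 sG j.+1).
    by rewrite svd_tr trGam /S trmxZ -scalemxAr -scalemxAl.
  have -> : (2 * g) *: (KG j.+1 *m Sigma1 sH j.+1 *m (Omega sG sH j.+1)^T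
               *m Sigma1 sG j.+1 *m KG j.+1) =
      KG j.+1 *m ((Sigma1 sG j.+1)^T *m Om *m Sigma1 sH j.+1)^T *m KG j.+1.
    by rewrite GamE trGamZ -scalemxAr -scalemxAl !mulmxA.
  have -> : KG j.+1 *m V *m diag_sqrt (1%:M + S^T *m S) =
      KG j.+1 *m (diag_sqrt (1%:M + S^T *m S) *m V^T)^T.
    by rewrite trmx_mul trmxK tr_diag_mx mulmxA.
  apply: compresses_doubled IHj _ _ _ _ _; rewrite ?GamE.
  - exact: whitener_inv.
  - have := whitener_inv oV oU (trmx_is_diag dS).
    by rewrite -trGam !trmxK.
  - exact: whitenerK.
  - by have := whitenerK oV (trmx_is_diag dS); rewrite trmxK.
  - exact: whitener_sv.
move=> j; split.
- case: (inv j.+1) => _ _; rewrite symH /gram_inv => E.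
  by rewrite /LG E.
- case: (compresses_tr (inv j.+1)) => _ _; rewrite symG /gram_inv trmxK => E.
  by rewrite /LH E KHE.
rewrite KGS.
rewrite -!mulmxA; congr (_ *m _); rewrite !mulmxA; congr (_ *m _).
rewrite /dsum !mulmx_block !(mul0mx, mulmx0, mul1mx, mulmx1, add0r, addr0).
by rewrite -!scalemxAr -!scalemxAl -svd_tr !mulmxA.
Qed.
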